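(* If $f:\mathbb{F}_2^n\to\mathbb{F}_2$ is $s$-plateaued and $wt(f)=2^{(n+s-2)/2}$, then $G_f$ (if connected) is the complete bipartite graph between the vectors in $\Omega_f$ and the vectors in $\mathbb{F}_2^n\setminus\Omega_f$ (if disconnected, it is a union of complete bipartite graphs). Moreover, $G_f$ is a strongly regular graph with $(e,d)=\left(0,2^{(n+s-2)/2}\right)$.
   Context: Here $n$ is a positive integer. A Boolean function in $n$ variables is a map $f:\mathbb{F}_2^n\to\mathbb{F}_2$. Its support is $\Omega_f=\{\mathbf{x}\in\mathbb{F}_2^n : f(\mathbf{x})=1\}$ and its weight is $wt(f)=|\Omega_f|$. The Walsh-Hadamard transform of $f$ is the integer-valued function $\mathcal{W}_{\hat f}(\mathbf{u})=\sum_{\mathbf{x}\in\mathbb{F}_2^n}(-1)^{f(\mathbf{x})}(-1)^{\mathbf{u}\cdot\mathbf{x}}$, $\mathbf{u}\in\mathbb{F}_2^n$, where $\mathbf{u}\cdot\mathbf{x}=\sum_{i=1}^n u_ix_i$. For a fixed integer $s$ (depending on $f$), $f$ is called $s$-plateaued if $|\mathcal{W}_{\hat f}(\mathbf{u})|\in\{0,2^{(n+s)/2}\}$ for all $\mathbf{u}\in\mathbb{F}_2^n$. The Cayley graph $G_f$ of $f$ has vertex set $\mathbb{F}_2^n$ and edge set $E_f=\{(\mathbf{w},\mathbf{u})\in\mathbb{F}_2^n\times\mathbb{F}_2^n : f(\mathbf{w}\oplus\mathbf{u})=1\}$, where $\oplus$ is addition in $\mathbb{F}_2^n$; it is regular of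 degree $wt(f)$. An $r$-regular graph with $v$ vertices is strongly regular with parameters $(v,r,e,d)$ if there are nonnegative integers $e,d$ such that for all vertices $\mathbf{u},\mathbf{v}$ the number of vertices adjacent to both $\mathbf{u}$ and $\mathbf{v}$ is $e$ if $\mathbf{u},\mathbf{v}$ are adjacent and $d$ if they are nonadjacent.
   Formalization: The disconnected clause is proved only when G_f has no loops (f(0)=0), and strong regularity only when G_f is connected; otherwise both fail, e.g. f=x+1 (n=s=1) gives two looped vertices, and f=x1x2 (n=2, s=0) gives 2K_2, where d would have to be 1. *)

(* Defs.v *)
From HB Require Import structures.
From mathcomp Require Import all_boot all_order all_algebra.
From mathcomp Require Import reals exp.

Set Implicit Arguments.
Unset Strict Implicit.
Unset Printing Implicit Defensive.

Import Order.TTheory GRing.Theory Num.Theory.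
Local Open Scope ring_scope.

Definition bool_fun (n : nat) := 'rV['F_2]_n -> 'F_2.

Section BooleanFunctions.
Variable n : nat.
Implicit Types (f : bool_fun n) (u x : 'rV['F_2]_n).

Definition bf_support f : {set 'rV['F_2]_n} := [set x | f x == 1].

Definition weight f : nat := #|bf_support f|.

Definition dot u x : 'F_2 := \sum_(i < n) u 0 i * x 0 i.

(* The exponents are elements of 'F_2, read as 0 or 1 through the coercion of
   ordinals to nat. *)
Definition walsh f u : int := \sum_x (-1) ^+ f x * (-1) ^+ dot u x.

(* The exponent (n + s) / 2 need not be an integer a priori, whence the real
   power. *)
Definition plateaued (R : realType) (s : int) f : Prop :=
  forall u, `|walsh f u|%:~R = 0 :> R \/
            `|walsh f u|%:~R = 2 `^ ((n%:Z + s)%:~R / 2) :> R.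

(* This relation has a loop at every vertex when f 0 = 1, and none otherwise. *)
Definition cayley_graph f : rel 'rV['F_2]_n := fun w u => f (w + u) == 1.

End BooleanFunctions.

Section Graphs.
Variable V : finType.
Implicit Types (e : rel V) (A B : {set V}).

Definition connected_graph e : Prop := forall x y, connect e x y.

(* The subgraph of e induced on A :|: B is the complete bipartite graph with
   parts A and B. *)
Definition complete_bipartite e A B : Prop :=
  [/\ A != set0, B != set0, [disjoint A & B] &
      {in A :|: B &, forall x y,
         e x y = (x \in A) && (y \in B) || (x \in B) && (y \in A)}].

(* Vertex-disjoint union: the blocks of P carry the complete bipartite graphs. *)
Definition union_of_complete_bipartite e : Prop :=
  exists P : {set {set V}},
    [/\ partition P [set: V],
        forall x y, e x y -> pblock P x = pblock P y &
        forall C, C \in P ->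
          exists A B, C = A :|: B /\ complete_bipartite e A B].

Definition regular_graph e (r : nat) : Prop := forall x, #|[set y | e x y]| = r.

Definition strongly_regular e (v r c d : nat) : Prop :=
  [/\ #|V| = v, regular_graph e r &
      forall x y, x != y ->
        #|[set z | e x z && e y z]| = if e x y then c else d].

End Graphs.

(* Main.v *)
Require Import Defs.
From mathcomp Require Import all_boot all_order all_algebra.
From mathcomp Require Import reals exp.
From mathcomp Require Import ring zify.
Import Order.TTheory GRing.Theory Num.Theory.
Local Open Scope ring_scope.

(** Write [S] for the support of [f], [k] for its size and [F u] for the
    character sum of [(-1) ^ (u . x)] over [x] in [S]. The weight hypothesis
    says that the nonzero absolute value [2 ^ ((n + s) / 2)] of the Walsh
    transform equals [2 k]. Since the Walsh transform at [u != 0] is [- 2 F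
    u], every [F u] is [0] or [+- k] ([support_sum_plateaued]; [F 0] is [k]
    anyway), and a sum of [k] signs has absolute value [k] only if the signs
    are all equal. Hence [u] contributes to the Fourier expansion of the
    indicator of [S] only if the character of [u] is constant on [S]. For [a],
    [b], [c] in [S] such a character takes the same value at [a + b + c] as at
    [a], so the indicator of [S] takes the same value at both points, and [S]
    is closed under sums of three elements: it is a coset of a subgroup [D]
    ([flat_of_character_sums]).

    The rest is about Cayley graphs whose connection set is such a coset [S].
    When [0] is not in [S], the union [H] of [S] and [D] is a group in which
    [D] has index two. Two vertices of a coset of [H] are adjacent exactly
    when they lie in different cosets of [D], so that each coset of [H]
    carries a complete bipartite graph; the components are the cosets of [H].

    In the connected case [0] is automatically not in [S]: otherwise [S] would
    be a group, connectedness would make it the whole space, and then the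
    Walsh transform at [0] would be [- 2 ^ n], which is neither [0] nor [+- 2
    k]. *)

(** * Character sums over the binary space *)

Section Characters.
Set Implicit Arguments.
Unset Strict Implicit.
Variable n : nat.
Implicit Types (u x y w : 'rV['F_2]_n) (S : {set 'rV['F_2]_n}).

Lemma F2P (b : 'F_2) : b = 0 \/ b = 1.
Proof. by case: b => [[|[|//]] ltb]; [left | right]; apply: val_inj. Qed.

Lemma addvv x : x + x = 0.
Proof.
by apply/rowP => i; rewrite !mxE; case: (F2P (x 0 i)) => ->; apply: val_inj.
Qed.

Lemma addvK x y : x + (x + y) = y.
Proof. by rewrite addrA addvv add0r. Qed.

Lemma addv_eq0 x y : (x + y == 0) = (x == y).
Proof.
apply/eqP/eqP => [xy0|->]; last exact: addvv.
by rewrite -[LHS]addr0 -xy0 addvK.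
Qed.

Definition chi u x : int := (-1) ^+ dot u x.

Lemma sign_F2D (a b : 'F_2) : (-1) ^+ (a + b)%R = (-1) ^+ a * (-1) ^+ b :> int.
Proof. by case: (F2P a) => ->; case: (F2P b) => ->. Qed.

Lemma dotC u x : dot u x = dot x u.
Proof. by apply: eq_bigr => i _; rewrite mulrC. Qed.

Lemma chiC u x : chi u x = chi x u.
Proof. by rewrite /chi dotC. Qed.

Lemma chiD u x y : chi u (x + y) = chi u x * chi u y.
Proof.
rewrite /chi -sign_F2D /dot -big_split /=; congr (_ ^+ nat_of_ord _).
by apply: eq_bigr => i _; rewrite mxE mulrDr.
Qed.

Lemma chi0 u : chi u 0 = 1.
Proof. by rewrite /chi /dot big1 // => i _; rewrite mxE mulr0. Qed.

Lemma chi_sqr u x : chi u x * chi u x = 1.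
Proof. by rewrite -chiD addvv chi0. Qed.

Lemma chiP u x : chi u x = 1 \/ chi u x = -1.
Proof. by rewrite /chi; case: (F2P (dot u x)) => ->; [left | right]. Qed.

(** A coordinate where [u] is nonzero gives a basis vector whose translation
    negates every term of the sum. *)
Lemma sum_chi u :
  \sum_x chi u x = if u == 0 then (2 ^ n)%:R else 0.
Proof.
case: ifPn => [/eqP-> | u_neq0].
  under eq_bigr do rewrite chiC chi0.
  by rewrite sumr_const card_mx card_Fp // mul1n.
have [i /eqP ui1] : exists i, u 0 i == 1.
  apply/existsP; apply: contra_neqT u_neq0; rewrite negb_exists => /forallP un1.
  apply/rowP => i; rewrite mxE.
  by case: (F2P (u 0 i)) (un1 i) => -> //; rewrite eqxx.
have chi_delta : chi u (delta_mx 0 i) = -1.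
  rewrite /chi /dot (bigD1 i) //= big1 => [|j /negPf ji].
    by rewrite mxE !eqxx ui1.
  by rewrite mxE ji andbF mulr0.
have: \sum_x chi u x = - \sum_x chi u x; last by lia.
rewrite {1}(reindex_inj (addrI (delta_mx 0 i))) /= -sumrN.
by apply: eq_bigr => x _; rewrite chiD chi_delta mulN1r.
Qed.

Definition char_sum S u : int := \sum_(x in S) chi u x.

Lemma char_sum0 S : char_sum S 0 = #|S|%:R.
Proof.
by rewrite /char_sum; under eq_bigr do rewrite chiC chi0; rewrite sumr_const.
Qed.

Lemma char_sum_inversion S w :
  \sum_u char_sum S u * chi u w = if w \in S then (2 ^ n)%:R else 0.
Proof.
under eq_bigr do rewrite mulr_suml.
rewrite exchange_big /=.
have inner x : \sum_u chi u x * chi u w = if x == w then (2 ^ n)%:R else 0.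
  rewrite -addv_eq0 -sum_chi.
  by apply: eq_bigr => u _; rewrite -chiD chiC.
under eq_bigr do rewrite inner.
rewrite -big_mkcondr /=; case: ifP => wS.
  by rewrite (big_pred1 w) // => x /=; case: eqP => [->|]; rewrite ?wS ?andbF.
by rewrite big_pred0 // => x; case: eqP => [->|]; rewrite ?wS ?andbF.
Qed.

(** The equality case of the triangle inequality for a sum of signs. *)
Lemma chi_constant S u x y :
  `|char_sum S u| = #|S|%:R -> x \in S -> y \in S -> chi u x = chi u y.
Proof.
move=> norm_eq.
(* [e] is the sign of the sum, the common value of the characters. *)
have [e ee1 sum_e] : exists2 e : int, e = 1 \/ e = -1 &
    \sum_(z in S) (1 - e * chi u z) = 0.
  have sumE e : \sum_(z in S) (1 - e * chi u z) = #|S|%:R - e * char_sum S u.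
    by rewrite sumrB sumr_const mulr_sumr.
  have [F_ge0|F_lt0] := leP 0 (char_sum S u).
    by exists 1; [left | rewrite sumE mul1r -norm_eq ger0_norm ?subrr].
  by exists (-1); [right | rewrite sumE mulN1r -norm_eq ltr0_norm ?subrr].
have term_ge0 z : z \in S -> 0 <= 1 - e * chi u z.
  by case: (chiP u z) => ->; case: ee1 => ->.
have term0 := psumr_eq0P term_ge0 sum_e.
move=> /term0 + /term0.
by case: ee1 => ->; lia.
Qed.

(** Over the two-element field, a nonempty set with this closure property is
    an affine subspace. *)
Definition flat S : Prop :=
  forall x y z, x \in S -> y \in S -> z \in S -> x + y + z \in S.

(** At [a + b + c] and at [a] the two Fourier expansions of the indicator of
    [S] agree term by term, because only characters constant on [S] occur. *)
Lemma flat_of_character_sums S :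
  (forall u, char_sum S u = 0 \/ `|char_sum S u| = #|S|%:R) -> flat S.
Proof.
move=> F_val a b c aS bS cS.
have: \sum_u char_sum S u * chi u (a + b + c) = \sum_u char_sum S u * chi u a.
  apply: eq_bigr => u _; case: (F_val u) => [->|F_max]; first by rewrite !mul0r.
  rewrite !chiD (chi_constant F_max bS aS) (chi_constant F_max cS aS).
  by rewrite chi_sqr mul1r.
rewrite !char_sum_inversion aS; case: ifP => // _ /eqP.
by rewrite eq_sym pnatr_eq0 expn_eq0.
Qed.

End Characters.

(** * Plateaued functions whose support is as small as the Walsh values allow *)

Section Plateaued.
Set Implicit Arguments.
Unset Strict Implicit.
Variables (n : nat) (f : bool_fun n).
Local Notation S := (bf_support f).

Lemma walshE u :
  walsh f u = (if u == 0 then (2 ^ n)%:R else 0) - 2 * char_sum S u.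
Proof.
rewrite -sum_chi /char_sum [\sum_(x in S) _]big_mkcond mulr_sumr -sumrB /=.
apply: eq_bigr => x _; rewrite inE -/(chi u x).
by case: (F2P (f x)) => ->; rewrite /= ?expr0 ?expr1; ring.
Qed.

(** Taking out a factor [2 ^ 1] of the peak value [2 ^ ((n + s) / 2)] leaves
    the weight, so the conditions on [f] can be stated over the integers. *)
Lemma walsh_values (R : realType) (s : int) :
  plateaued R s f ->
  (weight f)%:R = 2 `^ ((n%:Z + s - 2)%:~R / 2) :> R ->
  forall u, walsh f u = 0 \/ `|walsh f u| = 2 * (weight f)%:R.
Proof.
move=> f_plateaued f_weight u.
have peak : 2 `^ ((n%:Z + s)%:~R / 2) = (2 * (weight f)%:R : int)%:~R :> R.
  have -> : (n%:Z + s)%:~R / 2 = 1 + (n%:Z + s - 2)%:~R / 2 :> R.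
    by rewrite [in RHS]intrB; field.
  rewrite powRD; last by rewrite pnatr_eq0 implybT.
  by rewrite powRr1 // -f_weight intrM !mulrz_nat.
case: (f_plateaued u) => [/eqP|/eqP].
  by rewrite intr_eq0 normr_eq0 => /eqP; left.
by rewrite peak eqr_int => /eqP; right.
Qed.

Hypothesis walsh_val :
  forall u, walsh f u = 0 \/ `|walsh f u| = 2 * (weight f)%:R.

Lemma support_sum_plateaued u :
  char_sum S u = 0 \/ `|char_sum S u| = #|S|%:R.
Proof.
have [-> | /negPf u0] := eqVneq u 0.
  by right; rewrite char_sum0 normr_nat.
by case: (walsh_val u); rewrite walshE u0 /weight; lia.
Qed.

Lemma support_flat : flat S.
Proof. exact/flat_of_character_sums/support_sum_plateaued. Qed.

(** A full support would give [2 ^ n] as absolute value of the Walsh transform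
    at [0], where only [0] and [2 ^ (n + 1)] are allowed. *)
Lemma support_not_full : S != [set: _].
Proof.
apply/eqP => S_full.
have cardS : #|S| = (2 ^ n)%N by rewrite S_full cardsT card_mx card_Fp // mul1n.
have := walsh_val 0; rewrite walshE eqxx char_sum0 /weight cardS.
have : (0 < 2 ^ n)%N by rewrite expn_gt0.
by lia.
Qed.

End Plateaued.

(** * Cayley graphs of cosets of a subgroup *)

Section FlatCayley.
Set Implicit Arguments.
Unset Strict Implicit.
Variables (n : nat) (f : bool_fun n) (a : 'rV['F_2]_n).
Local Notation S := (bf_support f).
Local Notation e := (cayley_graph f).
Hypotheses (flatS : flat S) (aS : a \in S).
Implicit Types x y z : 'rV['F_2]_n.

Lemma cayleyE x y : e x y = (x + y \in S).
Proof. by rewrite inE. Qed.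

(** The subgroup of which [S] is a coset. *)
Definition direction : {set 'rV['F_2]_n} := [set x | a + x \in S].
Local Notation D := direction.

Lemma in_direction x : (x \in D) = (a + x \in S).
Proof. by rewrite inE. Qed.

Lemma direction0 : 0 \in D.
Proof. by rewrite in_direction addr0. Qed.

Lemma addSS x y : x \in S -> y \in S -> x + y \in D.
Proof. by move=> xS yS; rewrite in_direction addrA; apply: flatS. Qed.

Lemma addDS x y : x \in D -> y \in S -> x + y \in S.
Proof.
rewrite in_direction => axS yS.
by rewrite -(addvK a (x + y)) !addrA -[a + a + x]addrA flatS.
Qed.

Lemma addDD x y : x \in D -> y \in D -> x + y \in D.
Proof.
by move=> xD; rewrite [y \in _]in_direction in_direction addrCA; apply: addDS.
Qed.

Definition hull : {set 'rV['F_2]_n} := S :|: D.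
Local Notation H := hull.

Lemma hullD x y : x \in H -> y \in H -> x + y \in H.
Proof.
rewrite !in_setU => /orP[xS|xD] /orP[yS|yD]; apply/orP.
- by right; apply: addSS.
- by left; rewrite addrC; apply: addDS.
- by left; apply: addDS.
- by right; apply: addDD.
Qed.

(** The hull is a group containing the connection set [S], so a walk never
    leaves a coset of it. *)
Lemma connect_hull x y : connect e x y -> x + y \in H.
Proof.
case/connectP=> p; elim: p x => [|z p IHp] x /=.
  by move=> _ ->; rewrite addvv in_setU direction0 orbT.
case/andP=> xz zp y_last.
rewrite -(addvK z y) addrA hullD ?IHp // in_setU.
by rewrite cayleyE in xz; rewrite xz.
Qed.

Lemma support_full_of_connected : 0 \in S -> connected_graph e -> S = [set: _].
Proof.
move=> S0 conn; apply/setP => x; rewrite in_setT.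
have := connect_hull (conn 0 x).
rewrite add0r in_setU => /orP[//|xD].
by rewrite -[x]addr0 addDS.
Qed.

Hypothesis S0 : 0 \notin S.

Lemma support_direction_disjoint x : x \in D -> x \notin S.
Proof.
rewrite in_direction => axS; apply: contra S0 => xS.
by have := flatS axS xS aS; rewrite -(addrA a) addvv addr0 addvv.
Qed.

(** After translating [x0] to [0], adjacency means that the sum of two
    elements of [S :|: D] is in [S], and membership in [S] is the nontrivial
    character of the group [S :|: D] with kernel [D]. *)
Lemma hull_complete_bipartite x0 :
  complete_bipartite e [set x | x0 + x \in S] [set x | x0 + x \in D].
Proof.
split.
- by apply/set0Pn; exists (x0 + a); rewrite inE addvK.
- by apply/set0Pn; exists x0; rewrite inE addvv direction0.
- rewrite disjoint_sym disjoints_subset; apply/subsetP => x.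
  rewrite in_setC !(in_set (fun z => x0 + z \in _)).
  exact: support_direction_disjoint.
move=> x y; rewrite cayleyE !in_setU !(in_set (fun z => x0 + z \in _)).
have -> : x + y = (x0 + x) + (x0 + y) by rewrite addrACA addvv add0r.
move: (x0 + x) (x0 + y) => {}x {}y.
have D_notS z : z \in D -> (z \in S) = false.
  by move=> zD; apply: negPf; apply: support_direction_disjoint.
have S_notD z : z \in S -> (z \in D) = false.
  by move=> zS; apply: contraTF zS; apply: support_direction_disjoint.
case/orP=> [xS|xD] /orP[yS|yD].
- by rewrite (D_notS _ (addSS xS yS)) (S_notD _ xS) (S_notD _ yS) !andbF.
- by rewrite addrC addDS // xS yD.
- by rewrite addDS // xD yS orbT.
- by rewrite (D_notS _ (addDD xD yD)) (D_notS _ xD) (D_notS _ yD) andbF.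
Qed.

Lemma hull_equivalence : equivalence_rel (fun x y => x + y \in H).
Proof.
move=> x y z; split; first by rewrite addvv in_setU direction0 orbT.
move=> xyH; apply/idP/idP => [xzH | yzH].
  have -> : y + z = (x + y) + (x + z) by rewrite addrACA addvv add0r.
  exact: hullD.
by rewrite -(addvK y z) addrA hullD.
Qed.

Lemma cayley_union_of_complete_bipartite : union_of_complete_bipartite e.
Proof.
pose r x y := x + y \in H.
have r_equiv : {in [set: 'rV['F_2]_n] & &, equivalence_rel r}.
  by move=> x y z _ _ _; apply: hull_equivalence.
exists (equivalence_partition r [set: _]).
have part := equivalence_partitionP r_equiv.
split => // [x y|C /imsetP[x0 _ ->]].
  rewrite cayleyE => xyS; apply/eqP.
  rewrite eq_pblock ?(cover_partition part) ?in_setT //; last first.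
    by case/and3P: part.
  by rewrite pblock_equivalence_partition ?in_setT // /r in_setU xyS.
exists [set x | x0 + x \in S], [set x | x0 + x \in D]; split.
  apply/setP => x; rewrite in_setU !(in_set (fun z => x0 + z \in _)) -in_setU.
  by rewrite in_set in_setT.
exact: hull_complete_bipartite.
Qed.

Hypothesis conn : connected_graph e.

Lemma direction_complement : D = ~: S.
Proof.
apply/setP => x; rewrite in_setC; apply/idP/idP.
  exact: support_direction_disjoint.
by have := connect_hull (conn 0 x); rewrite add0r in_setU => /orP[->|].
Qed.

Lemma cayley_complete_bipartite : complete_bipartite e S (~: S).
Proof.
have := hull_complete_bipartite 0; rewrite -direction_complement.
have shift0 (A : {set 'rV['F_2]_n}) : [set x | 0 + x \in A] = A.
  by apply/setP => x; rewrite in_set add0r.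
by rewrite !shift0.
Qed.

Lemma cayley_regular : regular_graph e (weight f).
Proof.
move=> x; rewrite /weight -(card_imset S (addrI x)); apply: eq_card => y.
rewrite inE cayleyE; apply/idP/imsetP => [xyS | [z zS ->]].
  by exists (x + y); rewrite ?addvK.
by rewrite addvK.
Qed.

(** Adjacent vertices lie in different cosets of the direction and
    nonadjacent ones in the same coset, where neighbourhoods coincide. *)
Lemma cayley_strongly_regular :
  strongly_regular e (2 ^ n)%N (weight f) 0%N (weight f).
Proof.
split; [by rewrite card_mx card_Fp // mul1n | exact: cayley_regular |].
move=> x y _; have [xyS|xyNS] := boolP (e x y).
  apply/eqP; rewrite cards_eq0; apply/eqP/setP => z; rewrite !inE.
  apply: contraTF xyS => /andP[]; rewrite !cayleyE => xzS yzS.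
  apply: support_direction_disjoint.
  by have := addSS xzS yzS; rewrite addrACA addvv addr0.
have xyD : x + y \in D by rewrite direction_complement in_setC -cayleyE.
rewrite -(cayley_regular x); apply: eq_card => z; rewrite !inE.
apply: andb_idr; rewrite !cayleyE => xzS.
by have := addDS xyD xzS; rewrite addrACA addvv add0r.
Qed.

End FlatCayley.

Theorem theorem1 (R : realType) (n : nat) (s : int) (f : bool_fun n)
    (n_gt0 : (0 < n)%N)
    (f_plateaued : plateaued R s f)
    (f_weight : (weight f)%:R = 2 `^ ((n%:Z + s - 2)%:~R / 2) :> R) :
  [/\ connected_graph (cayley_graph f) ->
        complete_bipartite (cayley_graph f) (bf_support f) (~: bf_support f),
      ~ connected_graph (cayley_graph f) -> irreflexive (cayley_graph f) ->
        union_of_complete_bipartite (cayley_graph f) &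
      connected_graph (cayley_graph f) ->
        exists d : nat,
          d%:R = 2 `^ ((n%:Z + s - 2)%:~R / 2) :> R /\
          strongly_regular (cayley_graph f) (2 ^ n)%N (weight f) 0%N d].
Proof.
have walsh_val := walsh_values f_plateaued f_weight.
have flatS := support_flat walsh_val.
have [a aS] : exists a, a \in bf_support f.
  apply/set0Pn; rewrite -card_gt0 -/(weight f) -(ltr0n R) f_weight.
  by rewrite powR_gt0 // ltr0n.
have conn0 : connected_graph (cayley_graph f) -> 0 \notin bf_support f.
  move=> conn; apply: contra (support_not_full walsh_val) => S0.
  by apply/eqP; apply: support_full_of_connected flatS aS S0 conn.
split.
- by move=> conn; apply: (cayley_complete_bipartite flatS aS (conn0 conn)).
- move=> _ irr; apply: (cayley_union_of_complete_bipartite flatS aS).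
  by rewrite -(addvv 0) -cayleyE irr.
move=> conn; exists (weight f); split; first exact: f_weight.
exact: (cayley_strongly_regular flatS aS (conn0 conn)).
Qed.
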